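(* Let $K$ be a nonempty closed almost sun in a real normed linear space $X$. Then for every $r>0$, the set $$E_r(K)=\left\{ x_0-r\,\frac{x_0-p(x_0)}{\|x_0-p(x_0)\|} : x_0\in E(K),\ p(x_0)\in P_K(x_0),\ \|x_0-p(x_0)\|=d_K(x_0)>r\right\}$$ is dense in $X\setminus K$.
   Context: For a nonempty closed set $K\subset X$, $d_K(x)=\inf\{\|x-k\|: k\in K\}$ and $P_K(x)=\{k\in K:\|x-k\|=d_K(x)\}$. $E(K)$ is the set of $x\in X\setminus K$ with $P_K(x)\neq\emptyset$. $K$ is almost proximinal if $P_K(x)\ne\emptyset$ for a dense set of $x\in X\setminus K$. A point $x\in X\setminus K$ is a solar point of $K$ if there is $p(x)\in P_K(x)$ such that $p(x)\in P_K(x+t(x-p(x)))$ for all $t\ge0$. An almost proximinal set $K$ is an almost sun if the set of its solar points is dense in $X\setminus K$. *)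

(* Defs.v *)
From HB Require Import structures.
From mathcomp Require Import all_boot all_order all_algebra.
From mathcomp Require Import all_classical all_reals all_analysis.

Set Implicit Arguments.
Unset Strict Implicit.
Unset Printing Implicit Defensive.

Import Order.TTheory GRing.Theory Num.Theory.
Import numFieldNormedType.Exports.

Local Open Scope classical_set_scope.
Local Open Scope ring_scope.

(* [D] is a subset of [A] that is dense in [A] for the subspace topology. *)
Definition dense_in (T : topologicalType) (D A : set T) : Prop :=
  D `<=` A /\ A `<=` closure D.

Section BestApproximation.
Context {R : realType} {X : normedModType R}.
Implicit Types (K : set X) (x : X).

Definition set_dist K x : R := inf [set `|x - k| | k in K].

Definition metric_proj K x : set X :=
  [set k | K k /\ `|x - k| = set_dist K x].

Definition proj_domain K : set X :=
  [set x | (~` K) x /\ metric_proj K x !=set0].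

Definition almost_proximinal K : Prop := dense_in (proj_domain K) (~` K).

Definition solar_point K x : Prop :=
  (~` K) x /\
  exists2 p, metric_proj K x p &
    forall t : R, 0 <= t -> metric_proj K (x + t *: (x - p)) p.

Definition almost_sun K : Prop :=
  almost_proximinal K /\ dense_in [set x | solar_point K x] (~` K).

Definition retracted_set K (r : R) : set X :=
  [set y | exists x0 p : X,
    [/\ proj_domain K x0, metric_proj K x0 p,
        `|x0 - p| = set_dist K x0, r < set_dist K x0
      & y = x0 - r *: (`|x0 - p|^-1 *: (x0 - p))]].

End BestApproximation.

(* Main.v *)
(* Every solar point x is itself in the retracted set: push x away from its
   projection p by the distance r; solarity keeps p a nearest point, and
   retracting by r comes back to x. *)
Require Import Defs.
From HB Require Import structures.
From mathcomp Require Import all_boot all_order all_algebra.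
From mathcomp Require Import all_classical all_reals all_analysis.

Import Order.TTheory GRing.Theory Num.Theory.
Import numFieldNormedType.Exports.

Local Open Scope classical_set_scope.
Local Open Scope ring_scope.

(** Solar points are dense in the complement of [K] by assumption, so density follows by
    monotonicity of closure once each solar point is shown to be a retracted point
    ([solar_point_retracted]). That retracted points avoid [K] is a distance count
    ([retracted_set_subC]). *)

Lemma set_dist_le (R : realType) (X : normedModType R) (K : set X) (x k : X) :
  K k -> set_dist K x <= `|x - k|.
Proof.
move=> Kk; apply: ge_inf; last by exists k.
by exists 0 => _ [y _ <-].
Qed.

(** A retracted point lies at distance exactly [r] from [x0], too close to belong to [K] since
    [r < set_dist K x0]. *)
Lemma retracted_set_subC (R : realType) (X : normedModType R) (K : set X)
  (r : R) : 0 < r -> retracted_set K r `<=` ~` K.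
Proof.
move=> r_gt0 y [x0 [p [_ _ px0 rd yE]]] /(@set_dist_le _ _ _ x0).
have d_gt0 : 0 < `|x0 - p| by rewrite px0 (lt_trans r_gt0).
rewrite yE opprB addrC subrK normrZ normrZV ?unitfE ?gt_eqF//.
by rewrite mulr1 gtr0_norm// leNgt rd.
Qed.

Lemma solar_point_retracted (R : realType) (X : normedModType R) (K : set X)
  (r : R) : 0 < r -> solar_point K `<=` retracted_set K r.
Proof.
move=> r_gt0 x [nKx [p [Kp px] solar]].
have d_gt0 : 0 < `|x - p|.
  by rewrite normr_gt0 subr_eq0; apply: contra_notN nKx => /eqP ->.
set d := `|x - p| in d_gt0 *.
(* The point at distance [r] beyond [x] on the ray from [p] through [x]; solarity is used only at
   the parameter [t = r / d]. *)
pose x0 := x + (r / d) *: (x - p).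
have projx0 : metric_proj K x0 p by apply: solar; rewrite divr_ge0 ?ltW.
have x0pE : x0 - p = (1 + r / d) *: (x - p).
  by rewrite /x0 scalerDl scale1r addrAC.
have c_gt0 : 0 < 1 + r / d by rewrite addr_gt0 ?divr_gt0.
have nx0p : `|x0 - p| = (1 + r / d) * d by rewrite x0pE normrZ gtr0_norm.
have dx0 : set_dist K x0 = d + r.
  by rewrite -projx0.2 nx0p mulrDl mul1r divfK ?gt_eqF.
exists x0, p; split => //.
(* If [x0] were in [K], its distance [d + r] to [K] would be at most [0]. *)
- split; last by exists p.
  move=> /(@set_dist_le _ _ _ x0).
  by rewrite dx0 subrr normr0 leNgt addr_gt0.
- exact: projx0.2.
- by rewrite dx0 ltrDr.
(* The factor [1 + r / d] cancels: [x0 - p] and [x - p] have the same direction, so retracting by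
   [r] undoes the push. *)
- rewrite nx0p x0pE !scalerA -mulrA invfM mulrAC mulVf ?gt_eqF// mul1r.
  by rewrite /x0 addrK.
Qed.

Theorem lemma3p1 (R : realType) (X : normedModType R) (K : set X)
  (K0 : K !=set0) (clK : closed K) (sunK : almost_sun K)
  (r : R) (r_gt0 : 0 < r) :
  dense_in (retracted_set K r) (~` K).
Proof.
split; first exact: retracted_set_subC.
apply: subset_trans sunK.2.2 _.
exact/closureS/solar_point_retracted.
Qed.
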